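(* $\kappa=\kappa^b$, where $\kappa$ is Korenblum's constant for $\mathcal{A}^2(\mathbb{D})$ and $\kappa^b$ is Korenblum's constant for bounded analytic functions.
   Context: $\mathbb{D}=\{z\in\mathbb{C}:|z|<1\}$. The Bergman space $\mathcal{A}^2(\mathbb{D})$ is the set of analytic functions $f$ on $\mathbb{D}$ with $\|f\|_2=\left(\frac1\pi\int_{\mathbb{D}}|f(z)|^2\,dA(z)\right)^{1/2}<\infty$, where $dA$ is Lebesgue area measure. $S^1=\{f\in\mathcal{A}^2(\mathbb{D}):\|f\|_2=1\}$, and $\mathcal{H}^\infty$ is the space of bounded analytic functions on $\mathbb{D}$. Korenblum's constant $\kappa\in(0,1)$ is the best possible (largest) value of $c$ for which the following holds: whenever $f,g\in\mathcal{A}^2(\mathbb{D})$ satisfy $|f(z)|\le|g(z)|$ for $c<|z|<1$, one has $\|f\|_2\le\|g\|_2$. For $0<c<1$, $$F^b(c)=\inf_{f,g\in S^1\cap\mathcal{H}^\infty}\ \sup_{c\le|z|<1}\left|\frac{f(z)}{g(z)}\right|,$$ where $f/g$ is understood as a meromorphic function (common zeros cancelled, value $\infty$ at poles). One has $0<F^b(c)\le1$, and $\kappa^b$ is the number such that $F^b(c)=1$ for $0<c\le\kappa^b$ and $F^b(c)<1$ for $\kappa^b<c<1$. *)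

(* Defs.v *)
From HB Require Import structures.
From mathcomp Require Import all_boot all_order all_algebra.
From mathcomp Require Import complex.
From mathcomp Require Import all_classical all_reals all_analysis.
Set Implicit Arguments.
Unset Strict Implicit.
Unset Printing Implicit Defensive.
Import Order.TTheory GRing.Theory Num.Theory.
Import numFieldNormedType.Exports.
Import ComplexField.Normc.
Local Open Scope classical_set_scope.
Local Open Scope complex_scope.
Local Open Scope ring_scope.

(* Functions on the disc are total functions [R[i] -> R[i]] whose values outside
   the disc are never used; [normc] is the modulus with values in [R]. *)

Definition unit_disc (R : realType) : set R[i] := [set z | normc z < 1].

(* [R[i]^o] is [R[i]] with the topology of its norm. *)
Definition analytic_at (R : realType) (f : R[i] -> R[i]) (z0 : R[i]) : Prop :=
  exists (r : R) (a : nat -> R[i]), 0 < r /\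
    forall z, normc (z - z0) < r ->
      series (fun k => a k * (z - z0) ^+ k : R[i]^o) @ \oo --> (f z : R[i]^o).

Definition analytic_on_disc (R : realType) (f : R[i] -> R[i]) : Prop :=
  forall z, unit_disc z -> analytic_at f z.

(* Area measure is the product Lebesgue measure on [R * R], with (x, y)
   standing for x + iy; the norm takes values in [0, +oo]. *)
Definition bergman_norm (R : realType) (f : R[i] -> R[i]) : \bar R :=
  sqrte ((pi^-1)%:E *
    \int[(@lebesgue_measure R \x @lebesgue_measure R)%E]_(
        p in [set p : R * R | unit_disc (p.1 +i* p.2)])
      (normc (f (p.1 +i* p.2)) ^+ 2)%:E)%E.

Definition bergman_space (R : realType) : set (R[i] -> R[i]) :=
  [set f | analytic_on_disc f /\ (bergman_norm f < +oo)%E].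

Definition bergman_sphere (R : realType) : set (R[i] -> R[i]) :=
  [set f | bergman_space f /\ bergman_norm f = 1%E].

Definition Hinfty (R : realType) : set (R[i] -> R[i]) :=
  [set f | analytic_on_disc f /\
    exists M : R, forall z, unit_disc z -> normc (f z) <= M].

(* [v] is the modulus at [z] of the meromorphic function f/g: after the common
   zero (w - z)^m is cancelled, f1 and g1 do not both vanish at [z].
   Such an [m] exists unless f and g both vanish identically near [z]. *)
Definition quotient_modulus (R : realType) (f g : R[i] -> R[i]) (z : R[i])
    (v : \bar R) : Prop :=
  exists (m : nat) (f1 g1 : R[i] -> R[i]),
    [/\ analytic_at f1 z, analytic_at g1 z,
        exists2 r : R, 0 < r & forall w, normc (w - z) < r ->
          f w = (w - z) ^+ m * f1 w /\ g w = (w - z) ^+ m * g1 w,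
        ~ (f1 z = 0 /\ g1 z = 0) &
        v = if g1 z == 0 then +oo%E else (normc (f1 z / g1 z))%:E].

Definition sup_quotient (R : realType) (c : R) (f g : R[i] -> R[i]) : \bar R :=
  ereal_sup [set v | exists2 z : R[i],
    c <= normc z < 1 & quotient_modulus f g z v].

Definition Fb (R : realType) (c : R) : \bar R :=
  ereal_inf [set s | exists f g : R[i] -> R[i],
    [/\ (@bergman_sphere R `&` @Hinfty R) f,
        (@bergman_sphere R `&` @Hinfty R) g &
        s = sup_quotient c f g]].

Definition korenblum_property (R : realType) (c : R) : Prop :=
  forall f g : R[i] -> R[i], bergman_space f -> bergman_space g ->
    (forall z, c < normc z < 1 -> normc (f z) <= normc (g z)) ->
    (bergman_norm f <= bergman_norm g)%E.

Definition is_korenblum_constant (R : realType) (kappa : R) : Prop :=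
  [/\ 0 < kappa < 1, korenblum_property kappa &
      forall c : R, 0 < c < 1 -> korenblum_property c -> c <= kappa].

Definition is_bounded_korenblum_constant (R : realType) (kappab : R) : Prop :=
  [/\ 0 < kappab < 1,
      forall c : R, 0 < c <= kappab -> Fb c = 1%E &
      forall c : R, kappab < c < 1 -> (Fb c < 1)%E].

(* Main.v *)
Require Import Defs.
From mathcomp Require Import all_boot all_order all_algebra.
From mathcomp Require Import complex.
From mathcomp Require Import all_classical all_reals all_analysis.
From mathcomp Require Import measurable_realfun.
From mathcomp Require Import ring lra.

(** Why the two constants agree.

    Suppose first that [kappab < kappa]. Then [Fb kappa < 1], so there are unit
    vectors [f], [g] and [t < 1] with [|f| <= t |g|] on [kappa <= |z| < 1]. The
    function [t^-1 f] is dominated by [g] on the annulus but has norm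
    [t^-1 > 1], which contradicts the Korenblum property at [kappa]
    ([korenblum_le1_Fb]).

    Suppose now that [kappa < kappab], and choose [c] strictly between them. As
    [kappa] is the largest admissible radius, some [f], [g] satisfy [|f| <= |g|]
    on [c < |z| < 1] and yet [f] has the larger norm. The dilations [f (s z)] and
    [g (s z)] with [s < 1] are bounded, since a smaller closed disc is compact
    ([bounded_on_smaller_disc]), and satisfy the same inequality near
    [kappab <= |z| < 1] as soon as [c < s * kappab]. The change of variables
    [disc_energy_dilation] multiplies both squared norms by the same factor
    [s^-2] and restricts the integrals to [|z| < s]; by monotone convergence
    ([disc_energy_approx]) the strict inequality between the norms survives for
    [s] close to 1. After normalisation the quotient is bounded by the ratio of
    the norms, which is less than 1, so that [Fb kappab < 1]: a contradiction
    ([korenblum_fail_Fb_lt1]).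

    One degenerate case remains, [g = 0] with [f] vanishing on the annulus only.
    It is excluded by a dilation in the other direction
    ([korenblum_vanishing]).

    The analytic input is the behaviour of a power series at its centre: it is
    continuous there ([power_series_lipschitz]), and a zero can be factored out
    ([power_series_factor]). The second identifies
    the modulus of the meromorphic quotient [f/g], including at common zeros, in
    terms of inequalities between [|f|] and [|g|]. *)

Set Implicit Arguments.
Unset Strict Implicit.
Unset Printing Implicit Defensive.
Import Order.TTheory GRing.Theory Num.Theory.
Import numFieldNormedType.Exports.
Import ComplexField.Normc.
Local Open Scope classical_set_scope.
Local Open Scope complex_scope.
Local Open Scope ring_scope.

(** * The modulus of a complex number *)

Section ComplexModulus.
Variable R : realType.
Implicit Types (z w : R[i]) (r : R).

Lemma normr_normc z : `|z| = (normc z)%:C.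
Proof. by rewrite normc_def; case: z. Qed.

Lemma normc_ge0 z : 0 <= normc z.
Proof. by case: z => x y; exact: sqrtr_ge0. Qed.

Lemma normc_eq0 z : (normc z == 0) = (z == 0).
Proof. by apply/eqP/eqP => [/eq0_normc//|->]; exact: normc0. Qed.

Lemma normc_gt0 z : (0 < normc z) = (z != 0).
Proof. by rewrite lt_def normc_ge0 normc_eq0 andbT. Qed.

Lemma normc_real r : normc r%:C = `|r|.
Proof. by rewrite /normc /= expr0n addr0 sqrtr_sqr. Qed.

Lemma normcX z n : normc (z ^+ n) = normc z ^+ n.
Proof. by elim: n => [|n IH]; rewrite ?expr0 ?normc1 // !exprS normcM IH. Qed.

Lemma normcB z w : normc (z - w) = normc (w - z).
Proof. by rewrite -opprB normcN. Qed.

Lemma le_dist_normc z w : `|normc z - normc w| <= normc (z - w).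
Proof.
rewrite ler_norml; apply/andP; split.
  rewrite lerNl opprB lerBlDr normcB.
  by apply: le_trans (le_normcD _ _); rewrite subrK.
by rewrite lerBlDr; apply: le_trans (le_normcD _ _); rewrite subrK.
Qed.

Lemma normc_Re_le z : `|complex.Re z| <= normc z.
Proof. by rewrite -lecR -normr_normc; exact: normc_ge_Re. Qed.

Lemma normc_Im_le z : `|complex.Im z| <= normc z.
Proof.
case: z => x y /=; rewrite -sqrtr_sqr ler_sqrt ?addr_ge0 ?sqr_ge0//.
by rewrite lerDr sqr_ge0.
Qed.

Lemma normc_le_ReIm z : normc z <= `|complex.Re z| + `|complex.Im z|.
Proof.
case: z => x y; rewrite [X in normc X](_ : _ = x%:C + y%:C * 'i); last by simpc.
apply: le_trans (le_normcD _ _) _; rewrite normcM !normc_real.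
by rewrite /normc /= expr0n add0r expr1n sqrtr1 mulr1.
Qed.

(** Convergence in [R[i]^o] is tested by positive elements of [R[i]], which
    are the positive reals. *)
Lemma cvg_normcP (u : nat -> R[i]) (l : R[i]) :
  (u : nat -> R[i]^o) @ \oo --> (l : R[i]^o) <->
  forall e : R, 0 < e -> \forall n \near \oo, normc (l - u n) < e.
Proof.
split=> [/cvgrPdist_lt H e e0|H].
  have := H e%:C; rewrite ltcR => /(_ e0); apply: filterS => n.
  by rewrite normr_normc ltcR.
apply/cvgrPdist_lt => -[a b]; rewrite ltcE /= => /andP[/eqP -> a0].
by apply: filterS (H a a0) => n; rewrite normr_normc ltcR.
Qed.

End ComplexModulus.

(** * Power series near their centre *)

Section Analytic.
Variable R : realType.
Implicit Types (f g : R[i] -> R[i]) (z w : R[i]) (a b : nat -> R[i]).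

Definition power_series_on (r : R) a f z0 :=
  forall z, normc (z - z0) < r ->
    series (fun k => a k * (z - z0) ^+ k : R[i]^o) @ \oo --> (f z : R[i]^o).

(** The terms of the series are bounded at a point at distance [r / 2] from the
    centre; on the disc of radius [r / 4] the series is therefore dominated by a
    geometric series of ratio at most [1 / 2], from which one factor
    [normc (z - z0)] can be taken out. *)
Lemma power_series_lipschitz r a f z0 : 0 < r -> power_series_on r a f z0 ->
  exists2 C : R, 0 < C & forall z, normc (z - z0) <= r / 4 ->
    normc (f z - a 0%N) <= C * normc (z - z0).
Proof.
move=> r0 H; set s := r / 2.
have s0 : 0 < s by rewrite divr_gt0.
(* Convergent partial sums are eventually within 1 of the limit, so that all
   but finitely many terms are at most 2. *)
have [M M0 HM] : exists2 M : R, 0 < M & forall k, normc (a k) * s ^+ k <= M.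
  have E k : normc (a k) * s ^+ k = normc (a k * (z0 + s%:C - z0) ^+ k).
    by rewrite addrAC subrr add0r normcM normcX normc_real gtr0_norm.
  have /cvg_normcP/(_ 1 ltr01)[N _ HN] : series (fun k =>
      a k * (z0 + s%:C - z0) ^+ k : R[i]^o) @ \oo --> (f (z0 + s%:C) : R[i]^o).
    apply: H; rewrite addrAC subrr add0r normc_real gtr0_norm// /s; lra.
  have S0 : 0 <= \sum_(0 <= k < N) normc (a k) * s ^+ k.
    by apply: sumr_ge0 => k _; rewrite mulr_ge0 ?normc_ge0 ?exprn_ge0 ?ltW.
  exists (2 + \sum_(0 <= k < N) normc (a k) * s ^+ k).
    by rewrite ltr_pwDl.
  move=> k; have [kN|Nk] := ltnP k N; last first.
    rewrite E; set t := (X in normc X).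
    have := HN k Nk; have := HN k.+1 (leq_trans Nk (leqnSn k)).
    rewrite /= /series /= big_nat_recr //=.
    set l := f _; set S := \sum_(_ <= _ < _) _ => h1 h2.
    have -> : t = (l - S) - (l - (S + t)) by ring.
    apply: le_trans (le_normcD _ _) _; rewrite normcN; lra.
  rewrite (bigD1_seq k) ?mem_index_iota ?iota_uniq//= addrCA lerDl.
  apply: addr_ge0 => //; apply: sumr_ge0 => j _.
  by rewrite mulr_ge0 ?normc_ge0 ?exprn_ge0 ?ltW.
exists (2 * M / s); first by rewrite !mulr_gt0 ?invr_gt0.
move=> z zr; set x := normc (z - z0) / s.
have x0 : 0 <= x by rewrite divr_ge0 ?normc_ge0 ?ltW.
have x12 : x <= 2^-1 by rewrite ler_pdivrMr// /s; lra.
have T k : normc (a k.+1 * (z - z0) ^+ k.+1) <= M * x * 2^-1 ^+ k.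
  rewrite normcM normcX.
  have -> : normc (z - z0) = s * x by rewrite /x mulrC divfK ?gt_eqF.
  rewrite exprMn mulrA -[leRHS]mulrA; apply: ler_pM => //.
  - by rewrite mulr_ge0 ?normc_ge0 ?exprn_ge0 ?ltW.
  - by rewrite exprn_ge0.
  - by rewrite exprS ler_wpM2l// lerXn2r ?nnegrE ?invr_ge0.
have P n : normc (\sum_(0 <= k < n.+1) a k * (z - z0) ^+ k - a 0%N)
    <= M * x * (2 - 2 * 2^-1 ^+ n).
  elim: n => [|n IH].
    by rewrite big_nat1 expr0 !mulr1 !subrr normc0 mulr0.
  rewrite big_nat_recr //= addrAC.
  apply: le_trans (le_normcD _ _) _.
  apply: le_trans (lerD IH (T n)) _; rewrite -mulrDr.
  rewrite ler_wpM2l ?(mulr_ge0 (ltW M0) x0)//.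
  by rewrite exprS; lra.
rewrite -mulrA [_^-1 * _]mulrC -/x.
apply/ler_addgt0Pr => e e0.
have zr1 : normc (z - z0) < r by apply: le_lt_trans zr _; lra.
have /cvg_normcP/(_ e e0)[N _ HN] := H z zr1.
have := HN N.+1 (leqnSn N); rewrite /= /series /= => h.
rewrite -(subrKA (\sum_(0 <= k < N.+1) a k * (z - z0) ^+ k)).
apply: le_trans (le_normcD _ _) _; rewrite addrC lerD ?(ltW h)//.
apply: le_trans (P N) _; rewrite (_ : 2 * M * x = M * x * 2); last by ring.
rewrite ler_wpM2l ?(mulr_ge0 (ltW M0) x0)// lerBlDr lerDl.
by rewrite mulr_ge0 ?exprn_ge0 ?invr_ge0.
Qed.

Lemma power_series_center r a f z0 : 0 < r -> power_series_on r a f z0 ->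
  f z0 = a 0%N.
Proof.
move=> r0 H; have [C _ HC] := power_series_lipschitz r0 H.
apply/eqP; rewrite -subr_eq0 -normc_eq0 eq_le normc_ge0 andbT.
by have := HC z0; rewrite subrr normc0 mulr0; apply; rewrite divr_ge0 ?ltW.
Qed.

(** The expansion is used at its centre only; a function analytic on the disc has
    an expansion centred at each point, hence is continuous throughout. *)
Lemma analytic_at_continuous f z0 : analytic_at f z0 ->
  forall e : R, 0 < e -> exists2 d : R, 0 < d &
    forall z, normc (z - z0) < d -> normc (f z - f z0) < e.
Proof.
move=> [r [a [r0 H]]] e e0.
have [C C0 HC] := power_series_lipschitz r0 H.
exists (Num.min (r / 4) (e / C)); first by rewrite lt_min !divr_gt0.
move=> z; rewrite lt_min => /andP[zr ze].
rewrite (power_series_center r0 H); apply: le_lt_trans (HC z (ltW zr)) _.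
by rewrite mulrC -ltr_pdivlMr.
Qed.

Lemma analytic_at_near f g z0 (d : R) : 0 < d ->
  (forall z, normc (z - z0) < d -> f z = g z) ->
  analytic_at f z0 -> analytic_at g z0.
Proof.
move=> d0 fg [r [a [r0 H]]]; exists (Num.min r d), a.
split; first by rewrite lt_min r0.
by move=> z; rewrite lt_min => /andP[zr zd]; rewrite -fg//; exact: H.
Qed.

Lemma analytic_at0 z0 : analytic_at (fun=> 0 : R[i]) z0.
Proof.
exists 1, (fun=> 0); split=> [//|z _]; apply/cvg_normcP => e e0.
apply: nearW => n; rewrite /series /= big1 ?subrr ?normc0// => k.
by rewrite mul0r.
Qed.

Lemma analytic_atZ (c : R[i]) f z0 :
  analytic_at f z0 -> analytic_at (fun z => c * f z) z0.
Proof.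
move=> [r [a [r0 H]]]; exists r, (fun k => c * a k); split=> [//|z zr].
have c1 : 0 < normc c + 1 by apply: ltr_wpDl; [exact: normc_ge0|].
apply/cvg_normcP => e e0.
have /cvg_normcP/(_ _ (divr_gt0 e0 c1)) := H z zr.
apply: filterS => n; rewrite /series /=.
have -> : \sum_(0 <= k < n) c * a k * (z - z0) ^+ k =
    c * \sum_(0 <= k < n) a k * (z - z0) ^+ k.
  by rewrite mulr_sumr; apply: eq_bigr => k _; rewrite mulrA.
rewrite -mulrBr normcM ltr_pdivlMr// => h; rewrite mulrC.
apply: le_lt_trans h; apply: ler_wpM2l; first exact: normc_ge0.
by rewrite lerDl.
Qed.

Lemma analytic_at_dilation (s : R) f z0 : 0 < s ->
  analytic_at f (s%:C * z0) -> analytic_at (fun z => f (s%:C * z)) z0.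
Proof.
move=> s0 [r [a [r0 H]]]; exists (r / s), (fun k => a k * s%:C ^+ k).
split; first by rewrite divr_gt0.
move=> z zr; have E : s%:C * z - s%:C * z0 = s%:C * (z - z0) by rewrite mulrBr.
have := H (s%:C * z); rewrite E normcM normc_real gtr0_norm//.
rewrite mulrC -ltr_pdivlMr// => /(_ zr).
by under eq_fun do rewrite exprMn mulrA.
Qed.

(** If the first [m] coefficients vanish, the factor [(z - z0) ^+ m] can be
    divided out; the quotient is the power series with shifted coefficients. *)
Lemma power_series_factor r a f z0 m : 0 < r -> power_series_on r a f z0 ->
  (forall k, (k < m)%N -> a k = 0) ->
  exists f1, [/\ analytic_at f1 z0, f1 z0 = a m &
    forall w, normc (w - z0) < r -> f w = (w - z0) ^+ m * f1 w].
Proof.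
move=> r0 H a0.
pose f1 w := if w == z0 then a m else f w / (w - z0) ^+ m.
have f1z0 : f1 z0 = a m by rewrite /f1 eqxx.
have ff1 w : normc (w - z0) < r -> f w = (w - z0) ^+ m * f1 w.
  move=> wr; rewrite /f1; case: eqVneq => [->|wz].
    rewrite (power_series_center r0 H) subrr.
    by case: m {f1 f1z0} a0 => [_|m ->//]; rewrite ?expr0 ?mul1r// expr0n mul0r.
  by rewrite mulrC divfK// expf_neq0// subr_eq0.
exists f1; split=> [|//|//].
exists r, (fun k => a (k + m)%N); split=> [//|z zr].
apply/cvg_normcP => e e0; have [->|zz0] := eqVneq z z0.
  (* At the centre only the term of index 0 survives; the empty partial sum is
     skipped. *)
  exists 1%N => // -[//|n] _; rewrite /= /series /= big_nat_recl//= subrr.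
  rewrite big1 ?addr0 ?expr0 ?mulr1 ?f1z0 ?subrr ?normc0//.
  by move=> k _; rewrite expr0n mulr0.
have h0 : 0 < normc (z - z0) ^+ m by rewrite exprn_gt0// normc_gt0 subr_eq0.
have /cvg_normcP/(_ _ (mulr_gt0 e0 h0)) [N _ HN] := H z zr.
exists N => // n /= Nn; have := HN (n + m)%N (leq_trans Nn (leq_addr _ _)).
rewrite /= /series /= ff1// (big_cat_nat (n := m)) ?leq_addl//=.
have E0 : \sum_(0 <= k < m) a k * (z - z0) ^+ k = 0.
  rewrite big_nat_cond; apply: big1 => k.
  by rewrite andbT => /andP[_ /a0 ->]; rewrite mul0r.
have E1 : \sum_(m <= k < n + m) a k * (z - z0) ^+ k =
    (z - z0) ^+ m * \sum_(0 <= k < n) a (k + m)%N * (z - z0) ^+ k.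
  rewrite -{1}[m]add0n big_addn addnK mulr_sumr.
  by apply: eq_bigr => k _; rewrite exprD mulrA mulrC.
rewrite E0 add0r E1 -mulrBr normcM normcX mulrC.
by rewrite ltr_pM2r.
Qed.

End Analytic.

(** * Measurability of open sets and continuous functions in the plane *)

Section PlaneMeasure.
Variable R : realType.
Local Notation lam := (@lebesgue_measure R).
Local Notation T := (measurableTypeR R).
Implicit Types (f g : R[i] -> R[i]) (U V : set R[i]) (s : R).

(** Area measure lives on pairs of reals while functions live on [R[i]]. *)
Definition pt (p : T * T) : R[i] := p.1 +i* p.2.

(** Openness and continuity are spelt out with [normc] and real bounds, which
    serves both the norm of [R[i]] and the product topology and sigma-algebra of
    the plane. *)
Definition normc_open U :=
  forall z, U z -> exists2 d : R, 0 < d & forall w, normc (w - z) < d -> U w.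

(** An open set is the union of the boxes with rational centre and size that it
    contains. *)
Lemma measurable_normc_open U : normc_open U -> measurable (pt @^-1` U).
Proof.
move=> oU.
pose box (t : rat * rat * rat) : set (T * T) :=
  (`](ratr t.1.1 - ratr t.2), (ratr t.1.1 + ratr t.2)[ : set T) `*`
  (`](ratr t.1.2 - ratr t.2), (ratr t.1.2 + ratr t.2)[ : set T).
pose F t := if `[< box t `<=` pt @^-1` U >] then box t else set0.
have -> : pt @^-1` U = \bigcup_t F t.
  apply/seteqP; split=> [p /= Up|p [t _]]; last first.
    by rewrite /F; case: asboolP => // tU /tU.
  have [d d0 HU] := oU _ Up.
  have [//|q /itvP qd] := @rat_in_itvoo R 0 (d / 4); first by rewrite divr_gt0.
  have q0 : 0 < ratr q :> R by rewrite qd.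
  have close (x : R) : exists a : rat, `|x - ratr a| < ratr q.
    have [|a /itvP ax] := @rat_in_itvoo R (x - ratr q) (x + ratr q).
      by lra.
    by exists a; rewrite ltr_distlC !ax.
  have [[a ha] [b hb]] := (close p.1, close p.2).
  exists (a, b, q) => //; rewrite /F; case: asboolP => [_|[]].
    by move: ha hb; rewrite !ltr_distl /box /= => *; split; rewrite /= in_itv.
  move=> w [/=]; rewrite !in_itv /= => w1 w2; apply: HU.
  apply: le_lt_trans (normc_le_ReIm _) _; rewrite /pt /=.
  have {w1} : `|w.1 - ratr a| < ratr q by rewrite ltr_distl.
  have {w2} : `|w.2 - ratr b| < ratr q by rewrite ltr_distl.
  have qd4 : ratr q < d / 4 by rewrite qd.
  have := ler_distD (ratr a) w.1 p.1; have := ler_distD (ratr b) w.2 p.2.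
  rewrite (distrC (ratr a) p.1) (distrC (ratr b) p.2) => e2 e1 f2 f1.
  lra.
apply: countable_bigcupT_measurable => // t; rewrite /F; case: asboolP => // _.
by apply: measurableX; exact: measurable_itv.
Qed.

Lemma normc_open_disc s : normc_open [set z | normc z < s].
Proof.
move=> z /= zs; exists (s - normc z); first by rewrite subr_gt0.
move=> w ws; have := le_normcD (w - z) z; rewrite subrK; lra.
Qed.

Definition normc_continuous_on U f := forall z, U z -> forall e : R, 0 < e ->
  exists2 d : R, 0 < d & forall w, normc (w - z) < d -> normc (f w - f z) < e.

Lemma measurable_normc_continuous U f : normc_open U ->
  normc_continuous_on U f ->
  measurable_fun (pt @^-1` U) (fun p => normc (f (pt p)) : T).
Proof.
move=> oU cf; have mU := measurable_normc_open oU.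
apply: (measurability _ (RGenOInfty.measurableE R)).
move=> _ [_ [y ->] <-].
rewrite (_ : _ `&` _ = pt @^-1` [set z | U z /\ y < normc (f z)]); last first.
  by apply/seteqP; split=> p /=; rewrite in_itv /= andbT.
apply: measurable_normc_open => z [Uz yz].
have [d d0 Hd] := oU _ Uz.
have [e e0 He] := cf _ Uz (normc (f z) - y) ltac:(by rewrite subr_gt0).
exists (Num.min d e); first by rewrite lt_min d0.
move=> w; rewrite lt_min => /andP[wd we]; split; first exact: Hd.
have := He w we; have := le_dist_normc (f w) (f z); rewrite ler_norml.
by move=> /andP[]; lra.
Qed.

End PlaneMeasure.
Arguments pt {R} p.
Arguments normc_open_disc {R} s.

(** * Dilations and the energy of a function on a disc *)

Section Dilation.
Variable R : realType.
Local Notation lam := (@lebesgue_measure R).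
Local Notation T := (measurableTypeR R).
Implicit Types (f g : R[i] -> R[i]) (U V : set R[i]).
(** Both sides are measures in [A], and they agree on half-open intervals. *)
Lemma lebesgue_measure_dilation (s : R) (A : set T) : 0 < s -> measurable A ->
  lam A = (s%:E * lam [set x : T | A (s * x)%R])%E.
Proof.
move=> s0 mA; have ms : measurable_fun [set: T] ( *%R s : T -> T).
  exact: mulrl_measurable.
apply: (@lebesgue_measure_unique R
  (mscale (NngNum (ltW s0)) (pushforward lam ( *%R s : T -> T)))) => //.
move=> _ [[a b] _ <-] /=.
rewrite /mscale/= /pushforward.
rewrite (_ : _ @^-1` _ = `]a / s, b / s]%classic); last first.
  apply/seteqP; split=> x /=; rewrite !in_itv /=;
    by rewrite ltr_pdivrMr// ler_pdivlMr// ![x * s]mulrC.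
rewrite !lebesgue_measure_itv /= !lte_fin ltr_pM2r ?invr_gt0//.
case: ifP => _; last by rewrite mule0.
by rewrite -!EFinD -EFinM -mulrBl mulrC divfK ?gt_eqF.
Qed.

Local Notation mu := (lam \x lam)%E.

Definition dil (s : R) (p : T * T) : T * T := (s * p.1, s * p.2).

Lemma pt_dil s p : pt (dil s p) = s%:C * pt p.
Proof. by rewrite /pt /dil /=; simpc. Qed.

Lemma measurable_dil s : measurable_fun [set: T * T] (dil s).
Proof.
by apply: measurable_fun_pair; apply: measurableT_comp => //;
  exact: mulrl_measurable.
Qed.

(** By uniqueness of the product measure, rectangles suffice; each side of a
    rectangle contributes one factor [s]. *)
Lemma plane_measure_dilation (s : R) (X : set (T * T)) : 0 < s ->
  measurable X -> mu X = ((s ^+ 2)%:E * mu (dil s @^-1` X))%E.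
Proof.
move=> s0 mX; have s20 : 0 <= s ^+ 2 by rewrite exprn_ge0 ?ltW.
have md := measurable_dil s.
apply: (@product_measure_unique _ _ T T R lam lam
  (mscale (NngNum s20) (pushforward mu (dil s)))) => // A B mA mB.
rewrite /mscale /= /pushforward.
rewrite (lebesgue_measure_dilation s0 mA) (lebesgue_measure_dilation s0 mB).
have mdil (C : set T) : measurable C -> measurable [set x : T | C (s * x)%R].
  move=> mC; rewrite -[X in measurable X]setTI.
  by apply: (mulrl_measurable (D := [set: T]) s).
rewrite [LHS](_ : _ = (s ^+ 2)%:E * mu ([set x : T | A (s * x)%R] `*`
  [set x : T | B (s * x)%R]))%E //.
rewrite product_measure1E; [|exact: mdil|exact: mdil].
by rewrite expr2 EFinM muleACA.
Qed.

Lemma ge0_integral_dilation (s : R) (D : set (T * T)) (h : T * T -> \bar R) :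
  0 < s -> measurable D -> measurable_fun D h ->
  (forall p, D p -> 0 <= h p)%E ->
  (\int[mu]_(p in D) h p =
   (s ^+ 2)%:E * \int[mu]_(p in dil s @^-1` D) h (dil s p))%E.
Proof.
move=> s0 mD mh h0; have s20 : 0 <= s ^+ 2 by rewrite exprn_ge0 ?ltW.
have md := measurable_dil s.
rewrite -(ge0_integral_pushforward md mu mD mh); last first.
  by move=> p; rewrite inE; exact: h0.
rewrite -(ge0_integral_mscale (pushforward mu (dil s)) mD (NngNum s20) mh h0).
by apply: eq_measure_integral => A mA _; exact: plane_measure_dilation.
Qed.

Definition disc (s : R) : set (T * T) := [set p | normc (pt p) < s].

(** The square of the Bergman norm of [f] on a concentric disc, up to the factor
    [pi^-1]; working without the square root keeps the scaling rules simple. *)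
Definition disc_energy f (s : R) : \bar R :=
  (\int[mu]_(p in disc s) (normc (f (pt p)) ^+ 2)%:E)%E.

Lemma measurable_disc s : measurable (disc s).
Proof. exact: (measurable_normc_open (normc_open_disc s)). Qed.

Lemma measurable_energy U f : normc_open U -> normc_continuous_on U f ->
  measurable_fun (pt @^-1` U) (fun p : T * T => (normc (f (pt p)) ^+ 2)%:E).
Proof.
move=> oU cf; apply/measurable_EFinP; apply: measurable_funX.
exact: measurable_normc_continuous.
Qed.

Lemma energy_ge0 f (p : T * T) : (0 <= (normc (f (pt p)) ^+ 2)%:E)%E.
Proof. by rewrite lee_fin sqr_ge0. Qed.

Lemma disc_energy_ge0 f s : (0 <= disc_energy f s)%E.
Proof. by apply: integral_ge0 => p _; exact: energy_ge0. Qed.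

Lemma disc_energy_dilation f (s t : R) : 0 < s ->
  normc_continuous_on [set z | normc z < s * t] f ->
  (disc_energy f (s * t) =
   (s ^+ 2)%:E * disc_energy (fun z => f (s%:C * z)%R) t)%E.
Proof.
move=> s0 cf; rewrite /disc_energy.
rewrite (ge0_integral_dilation s0 (measurable_disc _)); last 2 first.
- exact: (measurable_energy (normc_open_disc (s * t)) cf).
- by move=> p _; exact: energy_ge0.
congr (_ * _)%E; under eq_integral do rewrite pt_dil.
congr (integral mu _ _); apply/funext => p.
by rewrite /preimage /disc /mkset pt_dil normcM normc_real gtr0_norm// ltr_pM2l.
Qed.

Lemma disc_energy_le f (s t : R) : s <= t ->
  normc_continuous_on [set z | normc z < t] f ->
  (disc_energy f s <= disc_energy f t)%E.
Proof.
move=> st cf; apply: ge0_subset_integral.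
- exact: measurable_disc.
- exact: measurable_disc.
- exact: (measurable_energy (normc_open_disc t) cf).
- by move=> p _; exact: energy_ge0.
- by move=> p /= ps; exact: lt_le_trans ps st.
Qed.

(** Monotone convergence along the discs of radius [1 - 1 / (n + 1)]. *)
Lemma disc_energy_approx f (y : \bar R) :
  normc_continuous_on [set z | normc z < 1] f -> (y < disc_energy f 1)%E ->
  exists2 d : R, d < 1 & forall s, d <= s < 1 -> (y < disc_energy f s)%E.
Proof.
move=> cf yI; pose F n := disc (1 - n.+1%:R^-1).
have E1 : disc 1 = \bigcup_n F n.
  apply/seteqP; split=> [p /= p1|p [n _] /=].
    have d0 : 0 < 1 - normc (pt p) by rewrite subr_gt0.
    have [n _ hn] := near_infty_natSinv_lt (PosNum d0).
    exists n => //=; have := hn n (leqnn n).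
    by rewrite /F /disc /mkset /= => h; rewrite ltrBrDl -ltrBrDr.
  rewrite /F /disc /= => h; apply: lt_le_trans h _.
  by rewrite lerBlDr lerDl invr_ge0.
have ndF : nondecreasing_seq F.
  move=> m n mn; rewrite subsetEset => p; rewrite /F /disc /= => h.
  apply: lt_le_trans h _.
  by rewrite lerB// lef_pV2 ?posrE// ler_nat.
have mF i : measurable (F i) by exact: measurable_disc.
have mf i : measurable_fun (F i) (fun p : T * T => (normc (f (pt p)) ^+ 2)%:E).
  apply: measurable_funS (measurable_energy (normc_open_disc 1) cf).
    exact: measurable_disc.
  by rewrite [X in _ `<=` X]E1 => p Fp; exists i.
have f0 i (p : T * T) : F i p -> (0 <= (normc (f (pt p)) ^+ 2)%:E)%E.
  by move=> _; exact: energy_ge0.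
have := @ge0_nondecreasing_set_cvg_integral _ _ _ F _ mu ndF mF mf f0.
have nd := @ge0_nondecreasing_set_nondecreasing_integral
  _ _ _ F _ mu ndF mF mf f0.
have := ereal_nondecreasing_cvgn nd; rewrite -E1 => c1 c2.
move: yI; rewrite /disc_energy -(cvg_unique _ c1 c2)//.
move=> /ereal_sup_gt[_ [n _ <-] yn].
exists (1 - n.+1%:R^-1); first by rewrite ltrBlDr ltrDl invr_gt0.
move=> s /andP[ns s1]; apply: lt_le_trans yn _; apply: (disc_energy_le ns).
by move=> z /= zs; apply: cf => /=; exact: lt_trans zs s1.
Qed.

End Dilation.

(** * The modulus of a quotient, and scaling of the Bergman norm *)

Section Quotient.
Variable R : realType.
Implicit Types (f g : R[i] -> R[i]) (z w : R[i]) (v : \bar R) (t : R).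

(** The order [m] of the common zero is the least index at which one of the two
    expansions has a nonzero coefficient. If there is none, both functions vanish
    at [z], which is harmless for an inequality between moduli. *)
Lemma analytic_quotient_modulus f g z : analytic_at f z -> analytic_at g z ->
  (f z = 0 /\ g z = 0) \/ exists v, quotient_modulus f g z v.
Proof.
move=> [r [a [r0 Hf]]] [s [b [s0 Hg]]].
have [[k Pk]|NP] := pselect (exists k, (a k != 0) || (b k != 0)); last first.
  have ab0 k : a k = 0 /\ b k = 0.
    have /negP := fun h => NP (ex_intro _ k h).
    by rewrite negb_or !negbK => /andP[/eqP -> /eqP ->].
  left; rewrite (power_series_center r0 Hf) (power_series_center s0 Hg).
  exact: ab0.
right; have exP : exists k, (a k != 0) || (b k != 0) by exists k.
case: (ex_minnP exP) => m Pm minm.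
have ab0 j : (j < m)%N -> a j = 0 /\ b j = 0.
  move=> jm; case: (boolP ((a j != 0) || (b j != 0))) => [/minm|].
    by rewrite leqNgt jm.
  by rewrite negb_or !negbK => /andP[/eqP -> /eqP ->].
have [f1 [af1 f1z Ef]] := power_series_factor r0 Hf (fun j jm => (ab0 j jm).1).
have [g1 [ag1 g1z Eg]] := power_series_factor s0 Hg (fun j jm => (ab0 j jm).2).
exists (if g1 z == 0 then +oo%E else (normc (f1 z / g1 z))%:E).
exists m, f1, g1; split; [exact: af1|exact: ag1| | |by []].
  exists (Num.min r s); first by rewrite lt_min r0.
  by move=> w; rewrite lt_min => /andP[/Ef ? /Eg].
by rewrite f1z g1z => -[am bm]; move: Pm; rewrite am bm eqxx.
Qed.

(** At [z] itself the factor [0 ^+ m] multiplies both sides, so [m] need not be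
    distinguished from [0]. *)
Lemma quotient_modulus_le f g z v t : quotient_modulus f g z v ->
  (v <= t%:E)%E -> normc (f z) <= t * normc (g z).
Proof.
move=> [m [f1 [g1 [_ _ [r r0 E] _ ->]]]].
case: ifPn => [_|g10]; first by rewrite leye_eq.
rewrite lee_fin normcM normcV ler_pdivrMr ?normc_gt0// => h.
have [-> ->] := E z ltac:(by rewrite subrr normc0).
rewrite !normcM mulrCA; apply: ler_wpM2l => //; exact: normc_ge0.
Qed.

(** The bound passes from [f / g] to [f1 / g1] off the point [z], and to [z]
    itself by continuity. *)
Lemma le_quotient_modulus f g z v t (d : R) : 0 <= t -> 0 < d ->
  (forall w, normc (w - z) < d -> normc (f w) <= t * normc (g w)) ->
  quotient_modulus f g z v -> (v <= t%:E)%E.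
Proof.
move=> t0 d0 fg [m [f1 [g1 [af1 ag1 [r r0 E] nz ->]]]].
have key : normc (f1 z) <= t * normc (g1 z).
  rewrite leNgt; apply/negP => lt1.
  (* Moving [f1] and [g1] by less than [e] changes the gap by at most
     [(1 + t) * e], which is less than the gap. *)
  pose e := (normc (f1 z) - t * normc (g1 z)) / (t + 2).
  have t2 : 0 < t + 2 by lra.
  have e0 : 0 < e by rewrite divr_gt0// subr_gt0.
  have Ee : e * (t + 2) = normc (f1 z) - t * normc (g1 z).
    by rewrite divfK ?gt_eqF.
  have [x x0 Hx] := analytic_at_continuous af1 e0.
  have [y y0 Hy] := analytic_at_continuous ag1 e0.
  pose u := Num.min (Num.min d r) (Num.min x y) / 2.
  have u0 : 0 < u by rewrite divr_gt0// !lt_min d0 r0 x0.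
  have : u < Num.min (Num.min d r) (Num.min x y).
    by rewrite ltr_pdivrMr// ltr_pMr ?ltr1n// !lt_min d0 r0 x0.
  rewrite !lt_min => /andP[/andP[ud ur] /andP[ux uy]].
  have wz : z + u%:C - z = u%:C by rewrite addrAC subrr add0r.
  have nu : normc (z + u%:C - z) = u by rewrite wz normc_real gtr0_norm.
  have [Ef Eg] := E (z + u%:C) ltac:(by rewrite nu).
  have := fg (z + u%:C) ltac:(by rewrite nu).
  have un : 0 < normc (u%:C ^+ m).
    by rewrite normcX normc_real gtr0_norm// exprn_gt0.
  rewrite Ef Eg wz !normcM mulrCA ler_pM2l// => h1.
  have := Hx (z + u%:C); rewrite nu => /(_ ux) h2.
  have := Hy (z + u%:C); rewrite nu => /(_ uy) h3.
  have := le_dist_normc (f1 (z + u%:C)) (f1 z).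
  have := le_dist_normc (g1 (z + u%:C)) (g1 z).
  rewrite !ler_norml => /andP[_ h4] /andP[h5 _].
  have h6 : normc (g1 (z + u%:C)) <= normc (g1 z) + e by lra.
  have := ler_wpM2l t0 h6; lra.
case: ifPn => [/eqP g10|g10].
  case: nz; split=> //; apply/eqP; rewrite -normc_eq0 eq_le normc_ge0 andbT.
  by move: key; rewrite g10 normc0 mulr0.
by rewrite lee_fin normcM normcV ler_pdivrMr ?normc_gt0.
Qed.

End Quotient.

Section BergmanNorm.
Variable R : realType.
Implicit Types (f g : R[i] -> R[i]).

Lemma analytic_on_disc_continuous f : analytic_on_disc f ->
  normc_continuous_on [set z | normc z < 1] f.
Proof. by move=> af z /af; exact: analytic_at_continuous. Qed.

Lemma bergman_normE f :
  bergman_norm f = sqrte ((pi^-1)%:E * disc_energy f 1)%E.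
Proof. by []. Qed.

Let pi_inv_gt0 : 0 < (pi : R)^-1. Proof. by rewrite invr_gt0 pi_gt0. Qed.

Lemma le_bergman_norm f g :
  (bergman_norm f <= bergman_norm g)%E = (disc_energy f 1 <= disc_energy g 1)%E.
Proof.
rewrite !bergman_normE lee_sqrt; last first.
  by rewrite mule_ge0 ?disc_energy_ge0// lee_fin ltW.
by rewrite lee_pmul2l// lte_fin.
Qed.

Lemma bergman_norm_lty f : (bergman_norm f < +oo)%E = (disc_energy f 1 < +oo)%E.
Proof.
rewrite bergman_normE; have := disc_energy_ge0 f 1.
by case: (disc_energy f 1) => [r|_|//] //=; rewrite ?ltry// gt0_muley// lte_fin.
Qed.

Lemma bergman_norm_gt0 f : (0 < bergman_norm f)%E = (0 < disc_energy f 1)%E.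
Proof.
rewrite bergman_normE; have := disc_energy_ge0 f 1.
case: (disc_energy f 1) => [r _|_|//] /=.
  by rewrite !lte_fin sqrtr_gt0 pmulr_rgt0.
by rewrite gt0_muley ?lte_fin// !ltry.
Qed.

Lemma disc_energyZ (k : R) f : normc_continuous_on [set z | normc z < 1] f ->
  disc_energy (fun z => k%:C * f z) 1 = ((k ^+ 2)%:E * disc_energy f 1)%E.
Proof.
move=> cf; rewrite /disc_energy -ge0_integralZl_EFin.
- apply: eq_integral => p _.
  by rewrite normcM normc_real exprMn real_normK ?num_real.
- exact: measurable_disc.
- by move=> p _; exact: energy_ge0.
- exact: (measurable_energy (normc_open_disc 1) cf).
- exact: sqr_ge0.
Qed.

Lemma bergman_normZ (k : R) f : 0 <= k -> analytic_on_disc f ->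
  bergman_norm (fun z => k%:C * f z) = (k%:E * bergman_norm f)%E.
Proof.
move=> k0 /analytic_on_disc_continuous cf.
rewrite !bergman_normE disc_energyZ// muleCA sqrteM ?lee_fin ?sqr_ge0//=.
by rewrite sqrtr_sqr ger0_norm.
Qed.

End BergmanNorm.

(** * Vanishing and boundedness of continuous functions on the disc *)

Section PlaneTopology.
Variable R : realType.
Local Notation lam := (@lebesgue_measure R).
Local Notation T := (measurableTypeR R).
Local Notation mu := (lam \x lam)%E.
Implicit Types (f g : R[i] -> R[i]) (z w : R[i]).

(** If [f] did not vanish at [z], its modulus would be at least half its value
    on a square around [z], and a square has positive area. *)
Lemma disc_energy_eq0 f : normc_continuous_on [set z | normc z < 1] f ->
  disc_energy f 1 = 0%E -> forall z, normc z < 1 -> f z = 0.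
Proof.
move=> cf I0 [x y] z1; apply: contrapT => /eqP fz0.
have e0 : 0 < normc (f (x +i* y)) / 2 by rewrite divr_gt0// normc_gt0.
set e := normc (f _) / 2 in e0.
have [d d0 Hd] := cf _ z1 e e0.
have [d' d'0 Hd'] := normc_open_disc 1 _ z1.
pose r := Num.min d d' / 2.
have r0 : 0 < r by rewrite divr_gt0// lt_min d0.
pose B : set (T * T) := (`](x - r), (x + r)[ : set T) `*`
  (`](y - r), (y + r)[ : set T).
have mB : measurable B by apply: measurableX; exact: measurable_itv.
have Bz p : B p -> normc (pt p - (x +i* y)) < Num.min d d'.
  move=> [h1 h2]; apply: le_lt_trans (normc_le_ReIm _) _.
  move: h1 h2; rewrite /= !in_itv /= -!ltr_distl => h1 h2.
  by rewrite (splitr (Num.min d d')) ltrD.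
have muB : (mu B = (r + r)%:E * (r + r)%:E)%E.
  rewrite product_measure1E; [|exact: measurable_itv|exact: measurable_itv].
  rewrite /= !lebesgue_measure_itv /= !lte_fin.
  rewrite !ltrBlDr -!addrA !ltrDl addr_gt0//.
  by congr (_ * _)%E; rewrite -EFinD; congr EFin; ring.
have : (\int[mu]_(p in B) (e ^+ 2)%:E <= disc_energy f 1)%E.
  have mf := measurable_energy (normc_open_disc 1) cf.
  have BD : B `<=` disc 1.
    by move=> p /Bz; rewrite lt_min => /andP[_]; exact: Hd'.
  apply: le_trans (ge0_subset_integral mu mB (measurable_disc 1) mf
    (fun p _ => energy_ge0 f p) BD).
  apply: ge0_le_integral => //.
  - by move=> p _; rewrite lee_fin sqr_ge0.
  - by apply: measurable_funS mf; [exact: measurable_disc|].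
  - move=> p /Bz; rewrite lt_min => /andP[/Hd h _].
    have := le_dist_normc (f (pt p)) (f (x +i* y)).
    rewrite ler_norml => /andP[h' _].
    rewrite lee_fin lerXn2r ?nnegrE ?normc_ge0 ?(ltW e0)//.
    have : normc (f (x +i* y)) = e + e by rewrite -splitr.
    lra.
rewrite integral_cst// I0 [X in (_ * X)%E]muB -!EFinM lee_fin leNgt.
move=> /negP; apply.
by apply: mulr_gt0; [exact: exprn_gt0|apply: mulr_gt0; exact: addr_gt0].
Qed.

Lemma normc_continuous_plane f (p : R * R) :
  (forall e : R, 0 < e -> exists2 d : R, 0 < d & forall w,
    normc (w - pt p) < d -> normc (f w - f (pt p)) < e) ->
  {for p, continuous (fun q : R * R => normc (f (pt q)))}.
Proof.
move=> cf; apply/cvgrPdist_lt => e e0; have [d d0 Hd] := cf e e0.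
have d20 : 0 < d / 2 by rewrite divr_gt0.
exists (ball p.1 (d / 2), ball p.2 (d / 2)).
  by split; exact: nbhsx_ballx.
move=> q [/= q1 q2]; apply: le_lt_trans (le_dist_normc _ _) _.
rewrite normcB; apply: Hd; apply: le_lt_trans (normc_le_ReIm _) _.
rewrite /pt /= [X in X + _]distrC [X in _ + X]distrC.
by rewrite [ltRHS]splitr ltrD.
Qed.

(** A closed disc is compact in the plane. This is what makes dilated functions
    bounded. *)
Lemma bounded_on_smaller_disc f (s : R) :
  normc_continuous_on [set z | normc z < 1] f -> 0 <= s < 1 ->
  exists M : R, forall z, normc z <= s -> normc (f z) <= M.
Proof.
move=> cf /andP[s0 s1].
pose A := [set p : R * R | normc (pt p) <= s].
have cA : compact A.
  apply: (@subclosed_compact _ _ (`[- s, s]%classic `*` `[- s, s]%classic)).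
  - apply: (@closed_comp _ _ (fun p : R * R => normc (pt p)) [set x | x <= s]).
      move=> p _; apply: (@normc_continuous_plane id) => e e0.
      by exists e.
    exact: closed_le.
  - by apply: compact_setX; exact: segment_compact.
  - move=> p /= ps; have := normc_Re_le (pt p); have := normc_Im_le (pt p).
    rewrite /= !in_itv /= -!ler_norml => h1 h2.
    by split; exact: le_trans ps.
have A0 : A !=set0.
  by exists (0, 0); rewrite /A /mkset -[pt _]/(0 : R[i]) normc0.
have [c _ Hc] := @compact_EVT_max _ _ (fun p : R * R => normc (f (pt p))) A A0 cA
  ltac:(apply: continuous_in_subspaceT => p; rewrite inE => ps;
    apply: normc_continuous_plane; apply: cf; exact: le_lt_trans ps s1).
exists (normc (f (pt c))) => -[x y] zs.
by apply: (Hc (x, y)); rewrite inE.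
Qed.
End PlaneTopology.

(** * Korenblum's property and bounded functions *)

Section Korenblum.
Variable R : realType.
Implicit Types (f g : R[i] -> R[i]) (z w : R[i]) (c kappa : R).

Lemma analytic_on_discZ (k : R[i]) f :
  analytic_on_disc f -> analytic_on_disc (fun z => k * f z).
Proof. by move=> af z /af; exact: analytic_atZ. Qed.

(** If [sup |f/g| <= t < 1] for unit vectors [f] and [g], then [t^-1 f] is still
    dominated by [g] on the annulus, although its norm exceeds 1. *)
Lemma korenblum_le1_Fb kappa : 0 < kappa < 1 -> korenblum_property kappa ->
  (1 <= Fb kappa)%E.
Proof.
move=> /andP[k0 k1] K; rewrite leNgt; apply/negP.
move=> /ereal_inf_lt[v [f [g [[[[af _] nf] _] [[[ag gfin] ng] _] {v}->]]] sup1].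
have [t /andP[t0 t1] supt] : exists2 t : R, 0 < t < 1 &
    (sup_quotient kappa f g <= t%:E)%E.
  have h1 : (2^-1 : R) < 1 by rewrite invf_lt1// ltr1n.
  have h0 : 0 < (2^-1 : R) by rewrite invr_gt0.
  case: (sup_quotient kappa f g) sup1 => [r|//|_].
    rewrite lte_fin => r1; exists (Num.max r 2^-1).
      by rewrite lt_max gt_max r1 h0 h1 orbT.
    by rewrite lee_fin le_max lexx.
  by exists 2^-1; rewrite ?leNye// h0 h1.
have le_fg z : kappa < normc z < 1 -> normc (f z) <= t * normc (g z).
  move=> /andP[kz z1].
  have [[-> ->]|[v qv]] := analytic_quotient_modulus (af z z1) (ag z z1).
    by rewrite normc0 mulr0.
  apply: (quotient_modulus_le qv); apply: le_trans supt.
  by apply: ereal_sup_ubound; exists z => //; rewrite (ltW kz).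
have t'0 : 0 <= t^-1 by rewrite invr_ge0 ltW.
pose f' z := (t^-1)%:C * f z.
have nf' : bergman_norm f' = (t^-1)%:E.
  by rewrite bergman_normZ// nf mule1.
have f'B : bergman_space f'.
  split; first exact: analytic_on_discZ.
  by rewrite nf' ltry.
have : (bergman_norm f' <= bergman_norm g)%E.
  apply: K => // z /le_fg h; rewrite normcM normc_real ger0_norm//.
  by rewrite mulrC ler_pdivrMr// mulrC.
by rewrite nf' ng lee_fin leNgt invf_gt1// t1.
Qed.

(** Extended by [0], a function vanishing on [c < |z| < 1] is analytic in the
    whole plane, so it can be contracted by [c / kappa] until it vanishes on
    [kappa < |z| < 1], where the property compares it with the zero function. *)
Lemma korenblum_vanishing kappa c f : 0 < kappa -> kappa <= c < 1 ->
  korenblum_property kappa -> bergman_space f ->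
  (forall z, c < normc z < 1 -> f z = 0) -> disc_energy f 1 = 0%E.
Proof.
move=> k0 /andP[kc c1] K [af]; rewrite bergman_norm_lty => finf f0.
have c0 : 0 < c by exact: lt_le_trans kc.
pose f1 z := if normc z < 1 then f z else 0.
have f1_0 z : c < normc z -> f1 z = 0.
  by rewrite /f1; case: ifP => // z1 cz; apply: f0; rewrite cz.
have f1E z : normc z < 1 -> f1 z = f z by rewrite /f1 => ->.
have af1 z : analytic_at f1 z.
  have [z1|z1] := ltP (normc z) 1.
    have [d d0 Hd] := normc_open_disc 1 z z1.
    by apply: (analytic_at_near d0) (af z z1) => w /Hd wd; rewrite f1E.
  have d0 : 0 < normc z - c by rewrite subr_gt0; exact: lt_le_trans z1.
  apply: (analytic_at_near d0) (analytic_at0 z) => w wd.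
  rewrite f1_0//; have := le_dist_normc w z; rewrite ler_norml => /andP[]; lra.
have cf1 U : normc_continuous_on U f1.
  by move=> z _; exact: analytic_at_continuous.
have Ef1 s : 1 <= s -> disc_energy f1 s = disc_energy f 1.
  move=> s1; rewrite /disc_energy integral_mkcond [RHS]integral_mkcond.
  congr (integral _ _ _); apply/funext => p; rewrite /patch.
  have [p1|p1] := ltP (normc (pt p)) 1.
    have -> : p \in disc 1 by apply/mem_set.
    have -> : p \in disc s by apply/mem_set; exact: lt_le_trans p1 s1.
    by rewrite f1E.
  rewrite f1_0 ?(lt_le_trans c1)// normc0 expr0n /= [RHS]ifF; last first.
    by apply/negP => /set_mem; rewrite /disc /mkset ltNge p1.
  by case: ifP.
pose r := c / kappa.
have r1 : 1 <= r by rewrite ler_pdivlMr// mul1r.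
have r0 : 0 < r by exact: lt_le_trans r1.
pose F z := f1 (r%:C * z).
have EF : (disc_energy f 1 = (r ^+ 2)%:E * disc_energy F 1)%E.
  rewrite -(Ef1 r r1) -[in LHS](mulr1 r) disc_energy_dilation//.
have aF : analytic_on_disc F by move=> z _; exact: analytic_at_dilation.
have finF : (disc_energy F 1 < +oo)%E.
  move: finf; rewrite EF; have := disc_energy_ge0 F 1.
  case: (disc_energy F 1) => [x _ _|_|//]; first exact: ltry.
  by rewrite gt0_muley// lte_fin exprn_gt0.
have FB : bergman_space F by split => //; rewrite bergman_norm_lty.
have E0 : disc_energy (fun=> 0 : R[i]) 1 = 0%E.
  rewrite /disc_energy (eq_integral (cst 0%E)) ?integral0// => p _.
  by rewrite normc0 expr0n.
have B0 : bergman_space (fun=> 0 : R[i]).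
  split; first by move=> z _; exact: analytic_at0.
  by rewrite bergman_norm_lty E0 ltry.
have F0 : disc_energy F 1 = 0%E.
  apply/eqP; rewrite eq_le disc_energy_ge0 andbT -E0 -le_bergman_norm.
  apply: K => // z /andP[kz z1].
  rewrite /F f1_0 ?normc0// normcM normc_real gtr0_norm//.
  by rewrite mulrAC ltr_pdivlMr// ltr_pM2l.
by rewrite EF F0 mule0.
Qed.

Lemma bergman_dilation f (s : R) : 0 < s < 1 -> bergman_space f ->
  let fs := fun z => f (s%:C * z) in
  [/\ bergman_space fs, Hinfty fs &
      (disc_energy f s = (s ^+ 2)%:E * disc_energy fs 1)%E].
Proof.
move=> /andP[s0 s1] [af]; rewrite bergman_norm_lty => finf fs.
have cf := analytic_on_disc_continuous af.
have sz z : unit_disc z -> normc (s%:C * z) <= s.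
  move=> /ltW z1; rewrite normcM normc_real gtr0_norm//.
  by rewrite -[leRHS]mulr1 ler_pM2l.
have afs : analytic_on_disc fs.
  move=> z z1; apply: analytic_at_dilation => //; apply: af.
  exact: le_lt_trans (sz z z1) s1.
have E : (disc_energy f s = (s ^+ 2)%:E * disc_energy fs 1)%E.
  rewrite -[in LHS](mulr1 s) disc_energy_dilation// mulr1 => z zs.
  by apply: cf => /=; exact: lt_trans zs s1.
split=> //.
- split=> //; rewrite bergman_norm_lty.
  have := le_lt_trans (disc_energy_le (ltW s1) cf) finf.
  rewrite E; have := disc_energy_ge0 fs 1.
  case: (disc_energy fs 1) => [x _ _|_|//]; first exact: ltry.
  by rewrite gt0_muley// lte_fin exprn_gt0.
- split=> //; have [|M HM] := @bounded_on_smaller_disc R f s cf.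
    by rewrite (ltW s0) s1.
  by exists M => z /sz; exact: HM.
Qed.

Lemma normalize_bounded f (a : R) : 0 < a -> bergman_space f -> Hinfty f ->
  bergman_norm f = a%:E ->
  (@bergman_sphere R `&` @Hinfty R) (fun z => (a^-1)%:C * f z).
Proof.
move=> a0 [af _] [_ [M HM]] nf.
have a'0 : 0 <= a^-1 by rewrite invr_ge0 ltW.
have n1 : bergman_norm (fun z => (a^-1)%:C * f z) = 1%E.
  by rewrite bergman_normZ// nf -EFinM mulVf ?gt_eqF.
have aZ := @analytic_on_discZ (a^-1)%:C f af.
split; first by split=> //; split=> //; rewrite n1 ltry.
split=> //; exists (a^-1 * M) => z /HM h.
by rewrite normcM normc_real ger0_norm// ler_wpM2l.
Qed.

(** A pair [f], [g] violating the property at [c], once dilated by [s] with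
    [c < s * c'], satisfies [|f (s z)| <= |g (s z)|] on a neighbourhood of
    [c' <= |z| < 1], and consists of bounded functions. By monotone convergence
    [s] can be so close to 1 that the norm of the dilated [f] still exceeds that
    of the dilated [g]; dividing both by their norms turns the ratio of the norms
    into a bound less than 1 for the quotient. *)
Lemma korenblum_fail_Fb_lt1 kappa c c' :
  0 < kappa -> kappa < c < c' -> c' < 1 ->
  korenblum_property kappa -> ~ korenblum_property c -> (Fb c' < 1)%E.
Proof.
move=> k0 /andP[kc cc'] c'1 K nK.
have [f [g [fB gB fg nfg]]] : exists f g, [/\ bergman_space f, bergman_space g,
    forall z, c < normc z < 1 -> normc (f z) <= normc (g z) &
    ~ (bergman_norm f <= bergman_norm g)%E].
  apply: contrapT => H; apply: nK => f g fB gB fg; apply: contrapT => h.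
  by apply: H; exists f, g.
move: nfg; rewrite le_bergman_norm => /negP; rewrite -ltNge => Egf.
have [af ag] := (fB.1, gB.1).
have cf := analytic_on_disc_continuous af.
have cg := analytic_on_disc_continuous ag.
(* [g] must not vanish identically, or it could not be normalised. *)
have Eg0 : (0 < disc_energy g 1)%E.
  rewrite lt_def disc_energy_ge0 andbT; apply/eqP => Eg0.
  have g0 := disc_energy_eq0 cg Eg0.
  have f0 z : c < normc z < 1 -> f z = 0.
    move=> cz; apply/eqP; rewrite -normc_eq0 eq_le normc_ge0 andbT.
    by have := fg z cz; rewrite g0 ?normc0//; case/andP: cz.
  have := korenblum_vanishing k0 _ K fB f0; rewrite (ltW kc) (lt_trans cc')//.
  by move=> /(_ isT) Ef0; move: Egf; rewrite Ef0 Eg0 ltxx.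
have [d1 d11 Hf] := disc_energy_approx cf Egf.
have [d2 d21 Hg] := disc_energy_approx cg Eg0.
(* The last entry is the midpoint of [c / c'] and 1; it gives [c < s * c']. *)
pose s := Num.max (Num.max d1 d2) ((c / c' + 1) / 2).
have c0 : 0 < c by exact: lt_trans kc.
have c'0 : 0 < c' by exact: lt_trans cc'.
have q0 : 0 < c / c' by rewrite divr_gt0.
have q1 : c / c' < 1 by rewrite ltr_pdivrMr// mul1r.
have s1 : s < 1 by rewrite !gt_max d11 d21 /=; lra.
have s0 : 0 < s by rewrite lt_max; apply/orP; right; lra.
have sc : c < s * c'.
  by rewrite -ltr_pdivrMr// lt_max; apply/orP; right; lra.
have {}Hf := Hf s ltac:(by rewrite s1 !le_max lexx).
have {}Hg := Hg s ltac:(by rewrite s1 !le_max lexx orbT).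
have s01 : 0 < s < 1 by rewrite s0.
have [fsB fsH Efs] := bergman_dilation s01 fB.
have [gsB gsH Egs] := bergman_dilation s01 gB.
set fs := fun z => f (s%:C * z) in fsB fsH Efs.
set gs := fun z => g (s%:C * z) in gsB gsH Egs.
have s20 : 0 < s ^+ 2 by rewrite exprn_gt0.
have ngf : (bergman_norm gs < bergman_norm fs)%E.
  rewrite ltNge le_bergman_norm -ltNge.
  rewrite -(@lte_pmul2l _ (s ^+ 2)%:E) ?lte_fin// -Efs -Egs.
  exact: le_lt_trans (disc_energy_le (ltW s1) cg) Hf.
have ng0 : (0 < bergman_norm gs)%E.
  rewrite bergman_norm_gt0 lt_def disc_energy_ge0 andbT.
  by apply: contraTN Hg => /eqP gs0; rewrite Egs gs0 mule0 ltxx.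
have [a na] : exists a, bergman_norm fs = a%:E.
  have [_] := fsB; have := lt_trans ng0 ngf.
  by case: (bergman_norm fs) => // a _ _; exists a.
have [b nb] : exists b, bergman_norm gs = b%:E.
  by have [_] := gsB; case: (bergman_norm gs) ng0 => // b _ _; exists b.
move: ngf ng0; rewrite na nb !lte_fin => ba b0.
have a0 : 0 < a by exact: lt_trans ba.
apply: (@le_lt_trans _ _ (b / a)%:E); last first.
  by rewrite lte_fin ltr_pdivrMr// mul1r.
pose f' z := (a^-1)%:C * fs z; pose g' z := (b^-1)%:C * gs z.
apply: (@le_trans _ _ (sup_quotient c' f' g')).
  apply: ereal_inf_lbound; exists f', g'.
  by split; [exact: normalize_bounded|exact: normalize_bounded|].
apply: ge_ereal_sup => v [z /andP[c'z z1] qv].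
have szc : c < s * normc z by apply: lt_le_trans sc _; rewrite ler_pM2l.
pose d := Num.min (1 - normc z) (normc z - c / s).
have d0 : 0 < d.
  by rewrite lt_min !subr_gt0 z1 ltr_pdivrMr// mulrC.
apply: (le_quotient_modulus _ d0 _ qv); first by rewrite divr_ge0 ?ltW.
move=> w; rewrite lt_min => /andP[w1 w2].
have := le_dist_normc w z; rewrite ler_norml => /andP[h1 h2].
have ws : c < normc w * s by rewrite -ltr_pdivrMr//; lra.
have nw1 : normc w < 1 by lra.
have : normc (fs w) <= normc (gs w).
  apply: fg; rewrite normcM normc_real gtr0_norm// mulrC ws /=.
  by apply: lt_trans s1; rewrite gtr_pMl.
rewrite /f' /g' !normcM !normc_real !gtr0_norm ?invr_gt0// => h.
rewrite mulrA [b / a * _]mulrAC divff ?gt_eqF// mul1r.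
by rewrite ler_wpM2l// invr_ge0 ltW.
Qed.

End Korenblum.

Theorem theorem6p2 (R : realType) (kappa kappab : R)
    (hkappa : is_korenblum_constant kappa)
    (hkappab : is_bounded_korenblum_constant kappab) :
  kappa = kappab.
Proof.
case: hkappa => /andP[k0 k1] Kk maxk; case: hkappab => /andP[b0 b1] Fb1 Fblt1.
apply/eqP; rewrite eq_le; apply/andP; split; rewrite leNgt; apply/negP => lt_k.
  have := Fblt1 kappa; rewrite lt_k k1 => /(_ isT).
  by rewrite ltNge korenblum_le1_Fb// k0.
have nK : ~ korenblum_property ((kappa + kappab) / 2).
  by move=> /maxk h; have := h ltac:(apply/andP; split; lra); lra.
have : (Fb kappab < 1)%E.
  by apply: (korenblum_fail_Fb_lt1 k0 _ b1 Kk nK); apply/andP; split; lra.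
by rewrite Fb1 ?ltxx// b0 lexx.
Qed.
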